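(* For every integer $m\ge1$, the $m$-dimensional Busemann–Hausdorff volume $\mu^{\rm bh}$ is Euclidean rigid. That is, if $\|\cdot\|$ is a norm on $\mathbf R^m$ with $\|\cdot\|\ge|\cdot|$ and $\mu^{\rm bh}_{\|\cdot\|}\le\mu^{\rm bh}_{|\cdot|}$, then $\|\cdot\|=|\cdot|$.
   Context: $|\cdot|$ is the standard Euclidean norm on $\mathbf R^m$ and $\alpha_m$ is the Lebesgue measure of its unit ball. An $m$-dimensional Finsler volume $\mu$ assigns to every $m$-dimensional normed space $V$ a Haar measure $\mu_V$ such that: (1) if $A:V\to W$ is linear with $\|A\|\le1$ then $\mu_W(A(B))\le\mu_V(B)$ for all Borel $B\subset V$; (2) if the norm of $V$ is induced by an inner product, $\mu_V$ is the standard Euclidean volume. For a norm $\|\cdot\|$ on $\mathbf R^m$ write $\mu_{\|\cdot\|}=\mu_{(\mathbf R^m,\|\cdot\|)}$. A Finsler volume $\mu$ is Euclidean rigid if every norm $\|\cdot\|$ on $\mathbf R^m$ with $\|\cdot\|\ge|\cdot|$ and $\mu_{\|\cdot\|}\le\mu_{|\cdot|}$ satisfies $\|\cdot\|=|\cdot|$. The Busemann–Hausdorff volume $\mu^{\rm bh}$ is the Finsler volume for which $\mu^{\rm bh}_V$ is the Haar measure on $V$ giving the closed unit ball $\mathbf B_V(0,1)$ measure $\alpha_m$ (it agrees with the $m$-dimensional Hausdorff measure of $V$). *)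

(* Defs.v *)
From HB Require Import structures.
From mathcomp Require Import all_boot all_order all_algebra.
From mathcomp Require Import all_classical all_reals all_analysis.
From mathcomp Require Import ring lra.

Set Implicit Arguments.
Unset Strict Implicit.
Unset Printing Implicit Defensive.

Import Order.TTheory GRing.Theory Num.Theory.
Import numFieldNormedType.Exports.

Local Open Scope classical_set_scope.
Local Open Scope ring_scope.

Record rV_norm (R : realType) (m : nat) := RVNorm {
  rV_norm_fun :> 'rV[R]_m -> R;
  rV_normD : forall x y,
    rV_norm_fun (x + y) <= rV_norm_fun x + rV_norm_fun y;
  rV_normZ : forall (l : R) x, rV_norm_fun (l *: x) = `|l| * rV_norm_fun x;
  rV_norm0_eq0 : forall x, rV_norm_fun x = 0 -> x = 0
}.

(* The normed space (R^m, N). The alias is needed because 'rV[R]_m already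
   carries the sup norm as its canonical norm. *)
Definition rV_normed (R : realType) (m : nat) (N : rV_norm R m) : Type :=
  'rV[R]_m.

Section rV_normed_instances.
Context (R : realType) (m : nat) (N : rV_norm R m).

HB.instance Definition _ := GRing.Lmodule.on (rV_normed N).
HB.instance Definition _ := @Lmodule_isNormed.Build R (rV_normed N)
  N (@rV_normD R m N) (@rV_normZ R m N) (@rV_norm0_eq0 R m N).

End rV_normed_instances.

Section euclidean_norm.
Context (R : realType) (m : nat).
Implicit Types x y : 'rV[R]_m.

Definition enorm_fun x : R := Num.sqrt (\sum_(i < m) x ord0 i ^+ 2).

Let sqr_sum_ge0 x : 0 <= \sum_(i < m) x ord0 i ^+ 2.
Proof. by apply: sumr_ge0 => i _; exact: sqr_ge0. Qed.

Lemma enorm_ge0 x : 0 <= enorm_fun x. Proof. exact: sqrtr_ge0. Qed.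

Lemma enorm_sqr x : enorm_fun x ^+ 2 = \sum_(i < m) x ord0 i ^+ 2.
Proof. by rewrite sqr_sqrtr. Qed.

Lemma enorm0_eq0 x : enorm_fun x = 0 -> x = 0.
Proof.
move=> x0; have := enorm_sqr x; rewrite x0 expr0n/= => /esym/eqP.
rewrite psumr_eq0; last by move=> i _; exact: sqr_ge0.
move=> /allP x_eq0; apply/rowP => i; rewrite mxE; apply/eqP.
by have := x_eq0 i (mem_index_enum i); rewrite /= sqrf_eq0.
Qed.

Lemma enormZ (l : R) x : enorm_fun (l *: x) = `|l| * enorm_fun x.
Proof.
rewrite /enorm_fun -sqrtr_sqr -sqrtrM ?sqr_ge0//; congr Num.sqrt.
by rewrite mulr_sumr; apply: eq_bigr => i _; rewrite mxE exprMn.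
Qed.

Lemma enorm_CauchySchwarz x y :
  \sum_(i < m) x ord0 i * y ord0 i <= enorm_fun x * enorm_fun y.
Proof.
set a := enorm_fun x; set b := enorm_fun y.
have [a0|a_neq0] := eqVneq a 0.
  rewrite (enorm0_eq0 a0) a0 mul0r big1// => i _.
  by rewrite mxE mul0r.
have [b0|b_neq0] := eqVneq b 0.
  rewrite (enorm0_eq0 b0) b0 mulr0 big1// => i _.
  by rewrite mxE mulr0.
have a_gt0 : 0 < a by rewrite lt_def a_neq0 enorm_ge0.
have b_gt0 : 0 < b by rewrite lt_def b_neq0 enorm_ge0.
have : 0 <= \sum_(i < m) (b * x ord0 i - a * y ord0 i) ^+ 2.
  by apply: sumr_ge0 => i _; exact: sqr_ge0.
have -> : \sum_(i < m) (b * x ord0 i - a * y ord0 i) ^+ 2 =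
    b ^+ 2 * (\sum_(i < m) x ord0 i ^+ 2)
    - 2 * (a * b) * (\sum_(i < m) x ord0 i * y ord0 i)
    + a ^+ 2 * (\sum_(i < m) y ord0 i ^+ 2).
  rewrite !mulr_sumr -sumrN -!big_split/=.
  by apply: eq_bigr => i _; ring.
rewrite -!enorm_sqr -/a -/b.
set s := \sum_(i < m) _ => s_ge0.
have ab_gt0 : 0 < 2 * (a * b) by rewrite !mulr_gt0.
rewrite -(ler_pM2l ab_gt0); nra.
Qed.

Lemma enormD x y : enorm_fun (x + y) <= enorm_fun x + enorm_fun y.
Proof.
rewrite -(@ler_pXn2r _ 2)// ?nnegrE ?addr_ge0 ?enorm_ge0//.
rewrite sqrrD !enorm_sqr.
have -> : \sum_(i < m) (x + y) ord0 i ^+ 2 = \sum_(i < m) x ord0 i ^+ 2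
    + (\sum_(i < m) x ord0 i * y ord0 i) *+ 2 + \sum_(i < m) y ord0 i ^+ 2.
  rewrite -mulr_natl mulr_sumr -!big_split/=.
  by apply: eq_bigr => i _; rewrite mxE; ring.
by rewrite lerD2r lerD2l lerMn2r enorm_CauchySchwarz orbT.
Qed.

Definition enorm : rV_norm R m := RVNorm enormD enormZ enorm0_eq0.

End euclidean_norm.
Arguments enorm {R m}.

(* Lebesgue outer measure on R^m: infimum of the total volume of countable
   covers by half-open boxes ]a_0, b_0] x ... x ]a_(m-1), b_(m-1)]. On Borel
   sets this is m-dimensional Lebesgue measure, for m > 0. *)
Section lebesgue_rV.
Context (R : realType) (m : nat).

Definition box (a b : 'rV[R]_m) : set 'rV[R]_m :=
  [set x | forall i, a ord0 i < x ord0 i <= b ord0 i].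

Definition box_vol (a b : 'rV[R]_m) : R :=
  \prod_(i < m) (b ord0 i - a ord0 i).

Definition lebesgue_rV (A : set 'rV[R]_m) : \bar R :=
  ereal_inf [set (\sum_(0 <= k <oo) (box_vol (c k).1 (c k).2)%:E)%E |
    c in [set c : nat -> 'rV[R]_m * 'rV[R]_m |
      (forall k i, (c k).1 ord0 i <= (c k).2 ord0 i) /\
      A `<=` \bigcup_k box (c k).1 (c k).2]].

End lebesgue_rV.

Definition alpha (R : realType) (m : nat) : \bar R :=
  lebesgue_rV (closed_ball_ (@enorm R m) 0 1).

Notation borelType V := (g_sigma_algebraType (@open V)).
Notation borel V := (@measurable _ (borelType V)).

Definition dim_eq (R : realType) (m : nat) (V : normedModType R) : Prop :=
  exists f : {linear 'rV[R]_m -> V}, bijective f.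

(* On finite-dimensional spaces regularity is automatic for Borel measures that
   are finite on compact sets, so it is not part of the definition. *)
Definition is_haar (R : realType) (V : normedModType R)
    (nu : {measure set (borelType V) -> \bar R}) : Prop :=
  [/\ nu setT != 0%E,
      forall K : set V, compact K -> (nu K < +oo)%E &
      forall (v : V) (B : set V), borel V B -> nu [set v + x | x in B] = nu B].

(* Only the values on spaces of dimension m are meaningful. *)
Record finsler_volume (R : realType) (m : nat) := FinslerVolume {
  vol :> forall V : normedModType R, {measure set (borelType V) -> \bar R};
  vol_haar : forall V : normedModType R, dim_eq m V -> is_haar (vol V);
  (* A @` B need not be Borel when A is not injective, hence the outer measure
     of vol W, which agrees with vol W on Borel sets. *)
  vol_le : forall V W : normedModType R, dim_eq m V -> dim_eq m W ->
    forall A : {linear V -> W}, (forall x : V, `|x| <= 1 -> `|A x| <= 1) ->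
    forall B : set V, borel V B -> ((vol W)^*%mu (A @` B) <= vol V B)%E;
  vol_euclidean : forall (V : normedModType R) (ip : {dot V for idfun}),
    dim_eq m V -> (forall x : V, `|x| = Num.sqrt (ip x x)) ->
    forall f : {linear 'rV[R]_m -> V}, (forall x, `|f x| = enorm x) ->
    forall B : set V, borel V B -> vol V B = lebesgue_rV (f @^-1` B)
}.

(* Borel sets of R^m are taken for the canonical topology of 'rV[R]_m, which is
   the topology of every norm on R^m. *)
Definition euclidean_rigid (R : realType) (m : nat)
    (mu : finsler_volume R m) : Prop :=
  forall N : rV_norm R m,
    (forall x, enorm x <= N x) ->
    (forall B : set 'rV[R]_m, borel 'rV[R]_m B ->
      (mu (rV_normed N) B <= mu (rV_normed enorm) B)%E) ->
    forall x, N x = enorm x.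

Definition is_busemann_hausdorff (R : realType) (m : nat)
    (mu : finsler_volume R m) : Prop :=
  forall V : normedModType R, dim_eq m V ->
    mu V (closed_ball_ Num.norm 0 1) = alpha R m.

(* Main.v *)
(** If the norm N dominates the Euclidean norm |.|, the N-ball is contained in
    the Euclidean ball, and the hypothesis gives mu_|.|(N-ball) >= mu_N(N-ball)
    = alpha = mu_|.|(Euclidean ball). As alpha is finite, the set difference of
    the two balls is mu_|.|-null. If N x > |x| somewhere, a rescaling of x is
    interior to that difference, whereas Haar measures charge every ball
    because countably many rational translates of it cover the space. *)
Require Import Defs.
From mathcomp Require Import all_boot all_order all_algebra.
From mathcomp Require Import all_classical all_reals all_analysis.
From mathcomp Require Import lra.

Set Implicit Arguments.
Unset Strict Implicit.
Unset Printing Implicit Defensive.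

Import Order.TTheory GRing.Theory Num.Theory.
Import numFieldNormedType.Exports.

Local Open Scope classical_set_scope.
Local Open Scope ring_scope.

Lemma lipschitz_continuous (R : realType) (V : normedModType R) (f : V -> R)
    (C : R) : (forall x y, `|f x - f y| <= C * `|x - y|) -> continuous f.
Proof.
move=> fC x; apply/cvgrPdist_lt => e e0.
(* [C] carries no sign hypothesis; [|C| + 1] is a larger Lipschitz constant by which one may
   divide. *)
have C1 : 0 < `|C| + 1 by rewrite ltr_wpDl.
near=> y.
apply: (le_lt_trans (fC x y)).
apply: (@le_lt_trans _ _ ((`|C| + 1) * `|x - y|)).
  by rewrite ler_wpM2r// (le_trans (ler_norm C))// lerDl.
rewrite mulrC -ltr_pdivlMr//; near: y.
by apply: (@cvgr_dist_lt _ _ _ _ _ id); [exact: cvg_id|rewrite divr_gt0].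
Unshelve. all: by end_near. Qed.

Lemma closed_measurable_borel (T : ptopologicalType) (A : set T) :
  closed A -> borel T A.
Proof.
move=> cA; rewrite -[A]setCK.
apply: (@measurableC _ (borelType T)); apply: sub_sigma_algebra.
exact: closed_openC.
Qed.

Section rV_norm.
Context (R : realType) (m : nat).
Implicit Types (N M : rV_norm R m) (x y : 'rV[R]_m).

Lemma rV_norm_dist N x y : `|N x - N y| <= N (x - y).
Proof. exact: (@ler_dist_dist _ (rV_normed N)). Qed.

Lemma rV_norm_le_coord N x : N x <= \sum_(i < m) `|x ord0 i| * N 'e_i.
Proof.
rewrite {1}(row_sum_delta x).
apply: (le_trans (ler_norm_sum (V := rV_normed N) _ _ _)).
by under eq_bigr do rewrite [`|_|]rV_normZ.
Qed.

(** Taking [g] to be the identity out of different normed copies of R^m gives continuity of [N] both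
    for the Euclidean alias and for the canonical sup norm: each of these norms dominates the
    coordinates, and [N] is Lipschitz with constant the sum of the [N 'e_i]. *)
Lemma rV_norm_continuous (V : normedModType R) (g : {linear V -> 'rV[R]_m}) N :
  (forall (v : V) i, `|g v ord0 i| <= `|v|) -> continuous (N \o g).
Proof.
move=> gi; apply: (@lipschitz_continuous _ _ _ (\sum_(i < m) N 'e_i)) => v w /=.
apply: (le_trans (rV_norm_dist _ _ _)); rewrite -linearB.
apply: (le_trans (rV_norm_le_coord _ _)).
rewrite mulr_suml; apply: ler_sum => i _.
by rewrite mulrC ler_wpM2l// (normr_ge0 ('e_i : rV_normed N)).
Qed.

End rV_norm.

Section haar.
Context (R : realType) (m : nat).

Lemma rV_rat_dense (N : rV_norm R m) (x : 'rV[R]_m) (e : R) : 0 < e ->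
  exists q : 'rV[rat]_m, N (x - map_mx ratr q) < e.
Proof.
(* Coordinate errors of at most [d] cost at most [d * C] in [N]. With [d = e / (C + 1)] the division
   is legitimate even for [C = 0] and the final bound is strict. *)
move=> e0; set C := \sum_(i < m) N 'e_i.
have C0 : 0 <= C.
  by apply: sumr_ge0 => i _; exact: (normr_ge0 ('e_i : rV_normed N)).
have C1 : 0 < C + 1 by rewrite ltr_wpDl.
have /choice[q qx] : forall i : 'I_m, exists r : rat,
    `|x ord0 i - ratr r| <= e / (C + 1).
  move=> i; have ec0 : 0 < e / (C + 1) by rewrite divr_gt0.
  have [|r] := @rat_in_itvoo R (x ord0 i) (x ord0 i + e / (C + 1)).
    by rewrite ltrDl.
  rewrite in_itv/= => /andP[xr rx]; exists r.
  by rewrite distrC gtr0_norm ?subr_gt0// lerBlDl ltW.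
exists (\row_i q i); apply: (le_lt_trans (rV_norm_le_coord _ _)).
apply: (@le_lt_trans _ _ (e / (C + 1) * C)).
  rewrite mulr_sumr; apply: ler_sum => i _; rewrite !mxE ler_wpM2r//.
  exact: (normr_ge0 ('e_i : rV_normed N)).
by rewrite mulrAC ltr_pdivrMr// ltr_pM2l// ltrDl.
Qed.

Lemma haar_ball_neq0 (N : rV_norm R m)
    (nu : {measure set (borelType (rV_normed N)) -> \bar R})
    (x : rV_normed N) (e : R) :
  is_haar nu -> 0 < e -> nu (ball x e) != 0%E.
Proof.
move=> [nuT _ nuD] e0; apply/eqP => nu0; move/eqP : nuT; apply.
(* Rational vectors are enumerated by their codes; an index that codes no vector contributes the
   empty set. *)
pose F (k : nat) : set (rV_normed N) :=
  if unpickle k is Some q then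
    ball ((map_mx ratr (q : 'rV[rat]_m) : rV_normed N) + x) e else set0.
have mball (y : rV_normed N) : borel (rV_normed N) (ball y e).
  by apply: sub_sigma_algebra; exact: ball_open.
have F0 k : nu.-negligible (F k).
  rewrite /F; case: unpickle => [q|]; last exact: negligible_set0.
  apply/negligibleP; first exact: mball.
  rewrite -nu0 -(nuD (map_mx ratr q) _ (mball x)); congr (nu _).
  rewrite -ball_normE; apply/seteqP; split=> [y qxy|_ [y xy <-]] /=.
    exists (y - map_mx ratr q); last by rewrite addrC subrK.
    by rewrite /= opprB addrA [x + _]addrC.
  by rewrite opprD addrACA subrr add0r.
have : nu.-negligible (\bigcup_k F k) by exact: negligible_bigcup.
suff -> : \bigcup_k F k = setT by move/negligibleP; exact.
apply/seteqP; split=> // y _.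
(* A rational [q] close to [y - x] puts [y] in the translate centred at [q + x]. *)
have [q qe] := @rV_rat_dense N (y - x) e e0.
exists (pickle q) => //; rewrite /F pickleK -ball_normE/= distrC opprD.
by rewrite [- _ - x]addrC addrA.
Qed.

End haar.

(** One box contains the ball and the rest of the cover is degenerate. For [m = 0] even a degenerate
    box has volume 1, an empty product, so the total would diverge. *)
Lemma alpha_lty (R : realType) (m : nat) : (0 < m)%N -> (alpha R m < +oo)%E.
Proof.
move=> m0.
(* Boxes omit their left faces, so a lower corner at -1 would miss points of the closed ball. *)
pose c (k : nat) : 'rV[R]_m * 'rV[R]_m :=
  if k is 0%N then (const_mx (- 2), const_mx 2) else (0, 0).
apply: (@le_lt_trans _ _ (box_vol (c 0%N).1 (c 0%N).2)%:E); last exact: ltry.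
apply: ereal_inf_lbound => /=; exists c; last first.
  have box0 : @box_vol R m 0 0 = 0.
    by rewrite /box_vol (bigD1 (Ordinal m0))//= subrr mul0r.
  apply: lim_near_cst => //.
  exists 1%N => // -[//|n] _ /=; rewrite big_nat_recl//= big1_seq ?adde0//.
  by move=> i _; rewrite box0.
split=> [[|k] i /=|x /=]; rewrite ?mxE ?lexx//.
  by lra.
rewrite /closed_ball_/= sub0r => xle1; exists 0%N => // i; rewrite !mxE.
have /ler_normlP[] : `|x ord0 i| <= 1.
  rewrite -sqrtr_sqr (le_trans _ xle1)//= ler_sqrt ?sumr_ge0//; last first.
    by move=> *; exact: sqr_ge0.
  rewrite (bigD1 i)//= mxE sqrrN lerDl sumr_ge0// => j _; exact: sqr_ge0.
by lra.
Qed.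

Theorem lemma2p5 (R : realType) (m : nat) (hm : (1 <= m)%N)
    (mu_bh : finsler_volume R m) (hbh : is_busemann_hausdorff mu_bh) :
  euclidean_rigid mu_bh.
Proof.
move=> N enormN muN x; apply/eqP; apply: contrapT => /negP Nx.
have {}Nx : enorm x < N x by rewrite lt_neqAle eq_sym Nx enormN.
have dimV (M : rV_norm R m) : dim_eq m (rV_normed M).
  by exists (idfun : {linear 'rV[R]_m -> 'rV[R]_m}); exists idfun.
pose mu := mu_bh (rV_normed (@enorm R m)).
pose V := rV_normed (@enorm R m).
have coordV (v : V) i : `|(v : 'rV[R]_m) ord0 i| <= `|v|.
  rewrite -sqrtr_sqr ler_sqrt ?sumr_ge0//; last by move=> *; exact: sqr_ge0.
  by rewrite (bigD1 i)//= lerDl sumr_ge0// => j _; exact: sqr_ge0.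
have cV (M : rV_norm R m) : continuous (M : V -> R).
  exact: (@rV_norm_continuous _ _ V (idfun : {linear 'rV[R]_m -> 'rV[R]_m})).
have cN : continuous N.
  apply: (@rV_norm_continuous _ _ _ (idfun : {linear 'rV[R]_m -> 'rV[R]_m})).
  move=> v i; rewrite [X in _ <= X]mx_normrE.
  exact: (le_bigmax _ (fun ij => `|v ij.1 ij.2|) (ord0, i)).
pose B (M : rV_norm R m) : set 'rV[R]_m := M @^-1` [set r | r <= 1].
have ballE M : closed_ball_ (@Num.norm R (rV_normed M)) 0 1 = B M.
  by apply/seteqP; split=> y; rewrite /closed_ball_/= sub0r normrN.
have mBV M : borel V (B M).
  by apply: closed_measurable_borel; apply: preimage_closed;
    [move=> ? _; exact: cV|exact: closed_le].
(* [muN] speaks of Borel sets of the canonical topology, while [mu] lives on those of [V]; the ball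
   of [N] must be measurable in both senses. *)
have mBN : borel 'rV[R]_m (B N).
  by apply: closed_measurable_borel; apply: preimage_closed;
    [move=> ? _; exact: cN|exact: closed_le].
have BNe : B N `<=` B enorm.
  by move=> y; rewrite /B/=; apply: le_trans; exact: enormN.
have muBe : mu (B enorm) = alpha R m by rewrite -(hbh _ (dimV enorm)) ballE.
have muBN : mu (B N) = alpha R m.
  apply/eqP; rewrite eq_le -{1}muBe le_measure ?inE//=.
  by rewrite -(hbh _ (dimV N)) ballE muN.
have muD : mu (B enorm `\` B N) = 0%E.
  have -> : mu (B enorm `\` B N) = (mu (B enorm) - mu (B N))%E.
    rewrite -{2}(setIidr BNe); apply: measureD; [exact: mBV|exact: mBV|].
    by rewrite [X in (X < _)%E]muBe alpha_lty.
  rewrite muBe muBN subee// ge0_fin_numE ?alpha_lty//.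
  by rewrite -muBe.
(* The reciprocal of the mean of [enorm x] and [N x]: scaling by it places 1 strictly between the
   two norms. *)
pose t := 2 / (enorm x + N x).
have x0 : 0 <= enorm x := enorm_ge0 x.
have t0 : 0 < t by rewrite divr_gt0//; lra.
have tE : t * (enorm x + N x) = 2 by rewrite divfK// gt_eqF//; lra.
have etx : enorm (t *: x) < 1 by rewrite rV_normZ gtr0_norm//; nra.
have Ntx : 1 < N (t *: x) by rewrite rV_normZ gtr0_norm//; nra.
(* Strict inequalities on both norms cut out an open part of [B enorm] minus [B N], so a whole ball
   around [t *: x] lies in a null set. *)
have oD : open ((enorm : V -> R) @^-1` [set r | r < 1] `&`
                (N : V -> R) @^-1` [set r | 1 < r]).
  by apply: openI; apply: open_comp;
    [move=> ? _; exact: cV|exact: open_lt|move=> ? _; exact: cV|exact: open_gt].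
have /nbhs_ballP[e e0 eD] := open_nbhs_nbhs (conj oD (conj etx Ntx)).
have /eqP := haar_ball_neq0 (t *: x : V) (vol_haar mu_bh (dimV enorm)) e0.
apply; apply/eqP; rewrite eq_le measure_ge0 andbT -muD.
rewrite le_measure ?inE//=.
- by apply: sub_sigma_algebra; exact: ball_open.
- by apply: measurableD; exact: mBV.
- move=> y /eD[/= ey Ny]; split; rewrite /B/=; first exact: ltW.
  by apply/negP; rewrite -ltNge.
Qed.
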